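(* Let $(d(t),h(t))$ be a proper Riordan array whose $A$-sequence has generating function $A(t)=(1+t)^q$, where $q\ge 1$ is an integer. Then $h$ is the hypergeometric function $$h(t)={}_{q}F_{q-1}\left(\begin{array}{c}\frac{q}{q},\frac{q+1}{q},\ldots,\frac{2q-1}{q}\\ \frac{q+1}{q-1},\frac{q+2}{q-1},\ldots,\frac{2q-1}{q-1}\end{array}\Bigg|\ \frac{q^q\,t}{(q-1)^{q-1}}\right),$$ also given by $$h(t)=\sum_{n=1}^\infty\frac{1}{(q-1)n+1}\binom{qn}{n}t^{n-1}=\sum_{n=1}^\infty\frac{1}{qn+1}\binom{qn+1}{n}t^{n-1}.$$ Moreover, for every $s\in\mathbb{R}$, $$\big(h(t)\big)^s={}_{q}F_{q-1}\left(\begin{array}{c}\frac{sq}{q},\frac{sq+1}{q},\ldots,\frac{(s+1)q-1}{q}\\ \frac{sq+1}{q-1},\frac{sq+2}{q-1},\ldots,\frac{(s+1)q-1}{q-1}\end{array}\Bigg|\ \frac{q^q\,t}{(q-1)^{q-1}}\right).$$ Consequently, $$\big(h(t)\big)^s=\sum_{n=0}^\infty\frac{qs}{(q-1)n+qs}\binom{q(n+s)-1}{n}t^n,$$ and therefore, for every $j$ such that $j-s$ is a nonnegative integer, $$[t^j]\big(th(t)\big)^s=[t^{j-s}]\big(h(t)\big)^s=\frac{qs}{(q-1)j+s}\binom{qj-1}{j-s}.$$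
   Context: $[t^n]g(t)$ denotes the coefficient of $t^n$ in $g(t)$. A Riordan array is an infinite lower triangular array $\{d_{n,k}\}_{n,k\ge0}$ defined by a pair of formal power series $(d(t),h(t))$ through $d_{n,k}=[t^n]\,d(t)\big(th(t)\big)^k$; it is proper if $h(0)\ne0$. The generating function $A(t)=\sum_{k\ge0}a_kt^k$ of the $A$-sequence of a proper Riordan array is the unique formal power series such that $h(t)=A\big(th(t)\big)$. The generalized hypergeometric series is the formal power series $${}_pF_q\left(\begin{array}{c}a_1,\ldots,a_p\\ c_1,\ldots,c_q\end{array}\Big|\ t\right)=\sum_{n=0}^\infty\frac{(a_1)_n\cdots(a_p)_n}{(c_1)_n\cdots(c_q)_n}\cdot\frac{t^n}{n!},$$ where $(a)_0=1$ and $(a)_n=a(a+1)\cdots(a+n-1)$ for $n\ge1$. In the claim the upper parameters are $\frac{sq+i}{q}$ for $i=0,\ldots,q-1$ and the lower ones are $\frac{sq+i}{q-1}$ for $i=1,\ldots,q-1$ (with $s=1$ in the first formula); for $q=1$ the lower list is empty and $0^0=1$. For real $x$ and an integer $n\ge0$, $\binom{x}{n}=x(x-1)\cdots(x-n+1)/n!$. The power $(h(t))^s$ for real $s$ is the usual formal power series power (here $h(0)=1$), and for real $s$, $[t^j](th(t))^s$ means $[t^{j-s}](h(t))^s$. For exceptional values of $s$ at which a denominator in a coefficient (of $t^n$, for fixed $n=j-s$ in the last formula) vanishes, the coefficient is understood as the value at $s$ of the polynomial in $s$ obtained after cancellation. *)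

(* Defs.v *)
From mathcomp Require Import all_boot all_order all_algebra.
From mathcomp Require Import reals.

Set Implicit Arguments.
Unset Strict Implicit.
Unset Printing Implicit Defensive.
Import Order.TTheory GRing.Theory Num.Theory.
Local Open Scope ring_scope.

(* A formal power series f is its coefficient sequence: f n = [t^n] f(t).
   Equality of series is pointwise equality, f =1 g. *)
Definition fps (R : Type) := nat -> R.

Section FormalPowerSeries.
Variable R : nzRingType.
Implicit Types f g : fps R.

Definition fps_one : fps R := fun n => (n == 0)%:R.
Definition fps_X : fps R := fun n => (n == 1)%:R.
Definition fps_add f g : fps R := fun n => f n + g n.
Definition fps_sub f g : fps R := fun n => f n - g n.
Definition fps_mul f g : fps R := fun n => \sum_(i < n.+1) f i * g (n - i)%N.
Definition fps_exp f (k : nat) : fps R := iter k (fps_mul f) fps_one.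

(* f(g(t)), for g with g(0) = 0: then [t^n] g^k = 0 for k > n, so the sum
   below is the whole of \sum_k f_k [t^n] g^k. *)
Definition fps_comp f g : fps R :=
  fun n => \sum_(k < n.+1) f k * fps_exp g k n.

(* f(c t) *)
Definition fps_scale_arg (c : R) f : fps R := fun n => c ^+ n * f n.

End FormalPowerSeries.

Arguments fps_one {R}.
Arguments fps_X {R}.

Section RiordanArrays.
Variable R : nzRingType.

Record riordan := Riordan { riordan_d : fps R; riordan_h : fps R }.

(* the (n, k) entry d_{n,k} = [t^n] d(t) (t h(t))^k *)
Definition riordan_entry (D : riordan) (n k : nat) : R :=
  fps_mul (riordan_d D) (fps_exp (fps_mul fps_X (riordan_h D)) k) n.

Definition proper_riordan (D : riordan) : Prop := riordan_h D 0%N != 0.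

(* h(t) = A(t h(t)). For a proper array t h(t) has order 1, so this
   determines A. *)
Definition A_sequence_gf (D : riordan) (A : fps R) : Prop :=
  riordan_h D =1 fps_comp A (fps_mul fps_X (riordan_h D)).

End RiordanArrays.

Section Hypergeometric.
Variable F : fieldType.

Definition gbinom (x : F) (n : nat) : F :=
  (\prod_(i < n) (x - i%:R)) / n`!%:R.

(* f(t)^s = \sum_k binom(s, k) (f(t) - 1)^k, for f with f(0) = 1 *)
Definition fps_rpow (f : fps F) (s : F) : fps F :=
  fps_comp (gbinom s) (fps_sub f fps_one).

Definition pochhammer (a : F) (n : nat) : F := \prod_(i < n) (a + i%:R).

(* the product (c_1)_n ... (c_q)_n *)
Definition pochhammers (cs : seq F) (n : nat) : F :=
  \prod_(c <- cs) pochhammer c n.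

Definition hypergeom (us ls : seq F) : fps F :=
  fun n => pochhammers us n / pochhammers ls n * (n`!%:R)^-1.

Definition upper_params (q : nat) (s : F) : seq F :=
  [seq (s * q%:R + i%:R) / q%:R | i <- iota 0 q].

(* i = 1, ..., q - 1 *)
Definition lower_params (q : nat) (s : F) : seq F :=
  [seq (s * q%:R + i%:R) / (q%:R - 1) | i <- iota 1 q.-1].

Definition hypergeom_q (q : nat) (s : F) : fps F :=
  fps_scale_arg (q%:R ^+ q / (q%:R - 1) ^+ q.-1)
    (hypergeom (upper_params q s) (lower_params q s)).

End Hypergeometric.

(* [t^j] (t f(t))^s = [t^(j - s)] f(t)^s for real j and s; only used when
   j - s is a natural number. *)
Definition coef_tpow (R : realType) (f : fps R) (s j : R) : R :=
  if j - s \is a Num.nat then fps_rpow f s (Num.truncn (j - s)) else 0.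

(* v is the value at s of the expression coef, with denominator den, after
   cancellation: den is a nonzero polynomial function, coef coincides with a
   polynomial P wherever den does not vanish, and v = P(s). By the two lemmas
   below v is unique, and is coef s itself when den s != 0. *)
Definition value_after_cancellation (R : numFieldType)
    (den coef : R -> R) (s v : R) : Prop :=
  exists P Q : {poly R},
    [/\ Q != 0, forall x, den x = Q.[x],
        forall x, den x != 0 -> coef x = P.[x] & v = P.[s]].

Lemma value_after_cancellation_regular (R : numFieldType)
    (den coef : R -> R) (s v : R) :
  value_after_cancellation den coef s v -> den s != 0 -> v = coef s.
Proof. by move=> [P [Q [_ _ cP ->]]] /cP. Qed.

Lemma value_after_cancellation_unique (R : numFieldType)
    (den coef : R -> R) (s v w : R) :
  value_after_cancellation den coef s v ->
  value_after_cancellation den coef s w -> v = w.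
Proof.
move=> [P [Q [Q0 dQ cP ->]]] [P' [_ [_ _ cP' ->]]].
have root0 x : ((P - P') * Q).[x] = 0.
  rewrite hornerM !hornerE -dQ; have [->|d0] := eqVneq (den x) 0.
    by rewrite mulr0.
  by rewrite -cP // -cP' // subrr mul0r.
have /eqP : (P - P') * Q = 0.
  apply/eqP/negPn/negP => p0.
  set p := (P - P') * Q in root0 p0 *.
  pose rs : seq R := [seq i%:R | i <- iota 0 (size p)].
  have rsr : all (root p) rs by apply/allP => x _; rewrite /root root0.
  have rsu : uniq rs.
    by rewrite map_inj_uniq ?iota_uniq // => i j /eqP; rewrite eqr_nat => /eqP.
  by have := max_poly_roots p0 rsr rsu; rewrite size_map size_iota ltnn.
by rewrite mulf_eq0 (negPf Q0) orbF subr_eq0 => /eqP ->.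
Qed.

(* Main.v *)
(* With w = t h and B = 1 + w, the equation h = A(w) says h = B^q and
   B = 1 + t B^q.  Hence c(n, r) = [t^n] B^r satisfies
   c(n + 1, r + 1) = c(n + 1, r) + c(n, r + q), c(n, 0) = 0 for n > 0 and
   c(0, r) = 1; the Rothe numbers r / n binom(qn + r - 1, n - 1) obey the same
   recurrence.  This gives [t^n] h^s = c(n, qs) for natural s, and both sides
   are polynomials in s, so the formula extends to all s.
   The multiplication formula (a)_{pn} = p^{pn} prod_{i<p} ((a + i)/p)_n turns
   the hypergeometric coefficient into (qs)_{qn} / ((qs + 1)_{(q-1)n} n!), which
   is c(n, qs). *)
Require Import Defs.
From mathcomp Require Import all_boot all_order all_algebra.
From mathcomp Require Import reals.
From mathcomp Require Import zify ring.
Import Order.TTheory GRing.Theory Num.Theory.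
Local Open Scope ring_scope.

Set Implicit Arguments.
Unset Strict Implicit.
Unset Printing Implicit Defensive.

(** * Power series read through polynomial truncations *)

Definition fps_trunc (R : nzRingType) (N : nat) (f : fps R) : {poly R} :=
  \poly_(i < N.+1) f i.

Lemma coef_fps_trunc (R : nzRingType) N (f : fps R) i :
  (i <= N)%N -> (fps_trunc N f)`_i = f i.
Proof. by move=> iN; rewrite coef_poly ltnS iN. Qed.

(** The coefficient of t^i in f^k involves only f_0, ..., f_i, so powers of series can be computed
    in the ring of polynomials. *)
Lemma fps_expE (R : nzRingType) N (f : fps R) (p : {poly R}) k i :
  (forall j, (j <= N)%N -> f j = p`_j) -> (i <= N)%N ->
  fps_exp f k i = (p ^+ k)`_i.
Proof.
move=> fp; elim: k i => [|k IH] i iN; first by rewrite expr0 coef1.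
rewrite exprS coefM; apply: eq_bigr => j _.
have jN : (j <= N)%N by rewrite (leq_trans _ iN) // -ltnS.
by rewrite fp // -IH // (leq_trans (leq_subr _ _)).
Qed.

Lemma coef_exp_order (R : nzRingType) (p : {poly R}) k i :
  p`_0 = 0 -> (i < k)%N -> (p ^+ k)`_i = 0.
Proof.
move=> p0; elim: k i => // k IH i; rewrite ltnS => ik.
rewrite exprS coefM big_ord_recl p0 mul0r add0r big1 // => j _.
by rewrite IH ?mulr0 //; move: (ltn_ord j); rewrite lift0; lia.
Qed.

(** The binomial theorem for (1 + g)^m. It serves twice: for A = (1 + t)^q at t h, and for the
    binomial series of h^m. *)
Lemma fps_comp_binomial (R : comNzRingType) (a g : fps R) m n :
  (forall k, a k = 'C(m, k)%:R) -> g 0%N = 0 ->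
  fps_comp a g n = fps_exp (fps_add fps_one g) m n.
Proof.
move=> aC g0; pose p := fps_trunc n g.
have gp j : (j <= n)%N -> g j = p`_j by move=> jn; rewrite coef_fps_trunc.
have p0 : p`_0 = 0 by rewrite -gp.
rewrite (@fps_expE _ n _ (1 + p)); last by [].
  rewrite exprDn coef_sum.
  pose F k := ('C(m, k)%:R : R) * (p ^+ k)`_n.
  (* A common range for both sums: terms with k > n vanish because p^k has order at least k, those
     with k > m because binom(m, k) = 0. *)
  transitivity (\sum_(k < m.+1 + n.+1) F k).
    rewrite /fps_comp (big_ord_widen (m.+1 + n.+1) (fun k => a k * fps_exp g k n)).
      rewrite big_mkcond; apply: eq_bigr => k _; rewrite /F.
      case: ltnP => kn; last by rewrite coef_exp_order ?mulr0.
      by rewrite aC (fps_expE _ gp).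
    by rewrite leq_addl.
  rewrite [RHS](eq_bigr (fun k : 'I_m.+1 => F k)); last first.
    by move=> k _; rewrite expr1n mul1r coefMn /F mulr_natl.
  rewrite [RHS](big_ord_widen (m.+1 + n.+1) F) ?leq_addr // big_mkcond /=.
  rewrite [RHS]big_mkcond; apply: eq_bigr => k _ /=.
  by case: ltnP => // km; rewrite /F bin_small ?mul0r.
by move=> j jn; rewrite coefD coef1 -gp.
Qed.

Lemma fps_exp_one_add_X (R : comNzRingType) m k :
  fps_exp (fps_add fps_one fps_X) m k = 'C(m, k)%:R :> R.
Proof.
rewrite (@fps_expE _ k _ (1 + 'X)) //; last first.
  by move=> j _; rewrite coefD coef1 coefX.
rewrite exprDn coef_sum.
under eq_bigr do rewrite expr1n mul1r coefMn coefXn -mulrnA mulnbl.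
rewrite -natr_sum -big_mkcond /=; under eq_bigl do rewrite eq_sym.
have [km|mk] := leqP k m; last first.
  rewrite bin_small // big1 // => i /eqP ik; move: (ltn_ord i).
  by rewrite ik ltnS leqNgt mk.
by rewrite (big_pred1 (Ordinal (km : (k < m.+1)%N))).
Qed.

(** * Functions given by polynomials *)

Section PolynomialFunctions.
Variable R : numFieldType.

Definition polyfun (f : R -> R) : Prop :=
  exists P : {poly R}, forall x, f x = P.[x].

Lemma polyfun_cst c : polyfun (fun=> c).
Proof. by exists c%:P => x; rewrite hornerC. Qed.

Lemma polyfun_id : polyfun id.
Proof. by exists 'X => x; rewrite hornerX. Qed.

Lemma polyfunD f g : polyfun f -> polyfun g -> polyfun (fun x => f x + g x).
Proof. by move=> [P fP] [Q gQ]; exists (P + Q) => x; rewrite hornerD fP gQ. Qed.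

Lemma polyfunM f g : polyfun f -> polyfun g -> polyfun (fun x => f x * g x).
Proof. by move=> [P fP] [Q gQ]; exists (P * Q) => x; rewrite hornerM fP gQ. Qed.

Lemma polyfun_sum n (F : nat -> R -> R) :
  (forall i, polyfun (F i)) -> polyfun (fun x => \sum_(i < n) F i x).
Proof.
move=> FP; elim: n => [|n [P nP]].
  by exists 0 => x; rewrite big_ord0 horner0.
by have [Q nQ] := FP n; exists (P + Q) => x; rewrite big_ord_recr hornerD -nP -nQ.
Qed.

Lemma polyfun_prod (I : Type) (r : seq I) (F : I -> R -> R) :
  (forall i, polyfun (F i)) -> polyfun (fun x => \prod_(i <- r) F i x).
Proof.
move=> FP; elim: r => [|a r [P nP]].
  by exists 1 => x; rewrite big_nil hornerC.
by have [Q nQ] := FP a; exists (Q * P) => x; rewrite big_cons hornerM -nP -nQ.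
Qed.

Lemma polyfun_affine a b : polyfun (fun x => a * x + b).
Proof.
by apply: polyfunD (polyfun_cst _); apply: polyfunM (polyfun_cst _) polyfun_id.
Qed.

Lemma polyfun_gbinom a b n : polyfun (fun x => gbinom (a * x + b) n).
Proof.
apply: polyfunM (polyfun_cst _); apply: polyfun_prod => i.
by apply: polyfunD (polyfun_cst _); exact: polyfun_affine.
Qed.

(** A nonzero P - Q would have as many distinct roots 0, 1, 2, ... as its size, which exceeds its
    degree. This carries identities from natural exponents to all exponents. *)
Lemma polyfun_eq_nat f g : polyfun f -> polyfun g ->
  (forall m : nat, f m%:R = g m%:R) -> f =1 g.
Proof.
move=> [P fP] [Q gQ] fg x; rewrite fP gQ; congr _.[x].
apply/eqP; rewrite -subr_eq0; apply/negPn/negP => p0.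
pose rs : seq R := [seq i%:R | i <- iota 0 (size (P - Q))].
have rsr : all (root (P - Q)) rs.
  by apply/allP => _ /mapP[i _ ->]; rewrite /root !hornerE -fP -gQ fg subrr.
have rsu : uniq rs.
  by rewrite map_inj_uniq ?iota_uniq // => i j /eqP; rewrite eqr_nat => /eqP.
by have := max_poly_roots p0 rsr rsu; rewrite size_map size_iota ltnn.
Qed.

Lemma polyfun_value_after_cancellation den coef val s :
  polyfun den -> polyfun val -> (exists x, den x != 0) ->
  (forall x, den x != 0 -> coef x = val x) ->
  value_after_cancellation den coef s (val s).
Proof.
move=> [Q dQ] [P vP] [x0 dx0] cv; exists P, Q; split=> //.
  by apply: contraNneq dx0 => Q0; rewrite dQ Q0 horner0.
by move=> x /cv ->.
Qed.

End PolynomialFunctions.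

(** * Generalized binomials and Rothe numbers *)

Section RotheNumbers.
Variable R : numFieldType.
Implicit Types (x a : R) (q n m : nat).

Lemma natS_neq0 n : n.+1%:R != 0 :> R.
Proof. by rewrite pnatr_eq0. Qed.

Lemma fact_neq0 n : n`!%:R != 0 :> R.
Proof. by rewrite pnatr_eq0 -lt0n fact_gt0. Qed.

Lemma gbinom_recl x n : gbinom x n.+1 = x / n.+1%:R * gbinom (x - 1) n.
Proof.
rewrite /gbinom big_ord_recl subr0 factS natrM invfM.
rewrite (eq_bigr (fun i : 'I_n => x - 1 - i%:R)); last first.
  by move=> i _; rewrite lift0 -natr1 opprD addrCA addrC.
by rewrite !mulrA; congr (_ / _); rewrite mulrAC.
Qed.

Lemma gbinom_recr x n : gbinom x n.+1 = (x - n%:R) / n.+1%:R * gbinom x n.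
Proof.
rewrite /gbinom big_ord_recr factS natrM invfM /=.
by rewrite !mulrA; congr (_ / _); rewrite -mulrA mulrC.
Qed.

Lemma gbinom0 x : gbinom x 0 = 1.
Proof. by rewrite /gbinom big_ord0 fact0 divr1. Qed.

Lemma gbinom_nat m n : gbinom m%:R n = 'C(m, n)%:R :> R.
Proof.
elim: n => [|n IH]; first by rewrite gbinom0 bin0.
rewrite gbinom_recr IH; apply: (mulfI (natS_neq0 n)).
rewrite -natrM mul_bin_left natrM.
(* The subtraction m - n in nat truncates when m < n, but then binom(m, n) = 0. *)
have [nm|mn] := leqP n m.
  by rewrite natrB //; field; rewrite addrC natr1 natS_neq0.
by rewrite bin_small // !mulr0.
Qed.

Lemma gbinom_pochhammer x n : gbinom (x + n%:R - 1) n = pochhammer x n / n`!%:R.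
Proof.
congr (_ / _); rewrite /pochhammer [RHS](reindex_inj rev_ord_inj).
by apply: eq_bigr => i _ /=; rewrite natrB // -natr1; ring.
Qed.

(** Where x + qn is nonzero this is x / (x + qn) binom(x + qn, n). Dividing by n instead keeps it
    polynomial in x; n = 0 is set apart. *)
Definition rothe q n x : R :=
  if n is m.+1 then x / n%:R * gbinom (x + (q * n)%:R - 1) m else 1.

Lemma polyfun_rothe q n a : polyfun (fun x => rothe q n (a * x)).
Proof.
case: n => [|n]; first exact: polyfun_cst.
apply: polyfunM.
  by apply: polyfunM (polyfun_cst _); apply: polyfunM (polyfun_cst _) (@polyfun_id R).
have [P HP] := polyfun_gbinom a ((q * n.+1)%:R - 1) n.
by exists P => x; rewrite -HP addrA.
Qed.

Lemma rotheD1 q n x :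
  rothe q n.+1 (x + 1) = rothe q n.+1 x + rothe q n (x + q%:R).
Proof.
case: n => [|n]; rewrite /rothe; first by rewrite !gbinom0 !divr1 !mulr1.
set Q : R := (q * n.+2)%:R.
have -> : x + q%:R + (q * n.+1)%:R - 1 = x + Q - 1.
  by rewrite /Q [(q * n.+2)%N]mulnS natrD addrA.
have -> : x + 1 + Q - 1 = x + Q by ring.
(* All three terms become rational multiples of binom(x + Q - 1, n). *)
rewrite gbinom_recl gbinom_recr -/Q /Q natrM -!natr1.
have n1 := natS_neq0 n; have n2 := natS_neq0 n.+1; rewrite -!natr1 in n1 n2.
by field; rewrite n1 n2.
Qed.

(** Induction on n, then on r. The bound [N] is there because truncated series obey the recurrence
    only up to a finite order. *)
Lemma rothe_unique q (c : nat -> nat -> R) (N : nat) :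
  (forall r, c 0%N r = 1) -> (forall n, c n.+1 0%N = 0) ->
  (forall n r, (n < N)%N -> c n.+1 r.+1 = c n.+1 r + c n (r + q)%N) ->
  forall n r, (n <= N)%N -> c n r = rothe q n r%:R.
Proof.
move=> c0 cn0 cS; elim=> [|n IHn] r nN; first by rewrite c0.
elim: r => [|r IHr]; first by rewrite cn0 /= !mul0r.
by rewrite cS // IHr IHn 1?ltnW // -natr1 rotheD1 natrD.
Qed.

(** For n > 0, the last factor in the numerator of binom(x + qn - 1, n) is x + (q - 1)n, which
    cancels the denominator. *)
Lemma rothe_gbinom q n x : x + (q.-1 * n)%:R != 0 -> (0 < q)%N ->
  rothe q n x = x / (x + (q.-1 * n)%:R) * gbinom (x + (q * n)%:R - 1) n.
Proof.
case: q => // q; case: n => [|n] /= den0 _.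
  by rewrite gbinom0 muln0 addr0 in den0 *; rewrite mulfV ?mulr1.
rewrite gbinom_recr; set g := gbinom _ _.
have -> : x + (q.+1 * n.+1)%:R - 1 - n%:R = x + (q * n.+1)%:R.
  by rewrite mulSn natrD -natr1; ring.
by rewrite !mulrA divfK // mulrAC.
Qed.

Lemma rothe1 q n : (0 < q)%N ->
  rothe q n.+1 1 = ((q%:R - 1) * n.+1%:R + 1)^-1 * 'C(q * n.+1, n.+1)%:R /\
  rothe q n.+1 1 = (q%:R * n.+1%:R + 1)^-1 * 'C(q * n.+1 + 1, n.+1)%:R.
Proof.
case: q => // q _; rewrite /rothe addrAC subrr add0r gbinom_nat.
set N := (q.+1 * n.+1)%N; have nN : (n <= N)%N by rewrite /N mulSn; lia.
have E1 : (q.+1%:R - 1) * n.+1%:R + 1 = (N - n)%:R :> R.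
  by rewrite natrB // natrM -!natr1; ring.
have E2 : q.+1%:R * n.+1%:R + 1 = N.+1%:R :> R by rewrite -natrM natr1.
have Nn0 : (N - n)%:R != 0 :> R by rewrite pnatr_eq0 /N mulSn; lia.
(* The goal concerns binom(N, n) / (n + 1); these two absorption identities turn it into binom(N, n
   + 1) and binom(N + 1, n + 1). *)
have H1 := mul_bin_left N n; have H2 := mul_bin_diag N.+1 n.
rewrite E1 E2 addn1; split.
  apply: (mulfI Nn0); rewrite mulVKf //; apply: (mulfI (natS_neq0 n)).
  by rewrite -[RHS]natrM H1 natrM div1r mulrCA mulVKf ?natS_neq0.
apply: (mulfI (natS_neq0 N)); rewrite mulVKf ?natS_neq0 //.
apply: (mulfI (natS_neq0 n)).
by rewrite -[RHS]natrM -H2 natrM div1r mulrCA mulVKf ?natS_neq0.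
Qed.

End RotheNumbers.

(** * Pochhammer symbols and hypergeometric coefficients *)

Section Pochhammer.
Variable R : numFieldType.
Implicit Types (x a : R) (p q n m : nat).

Lemma pochhammerD a m n :
  pochhammer a (m + n) = pochhammer a m * pochhammer (a + m%:R) n.
Proof.
rewrite /pochhammer big_split_ord; congr (_ * _); apply: eq_bigr => i _ /=.
by rewrite natrD addrA.
Qed.

Lemma pochhammer_pos a n : 0 < a -> 0 < pochhammer a n.
Proof. by move=> a0; apply: prodr_gt0 => i _; rewrite ltr_pwDl. Qed.

(** The factors a + pk + i = p ((a + i)/p + k) are grouped by the residue i modulo p. *)
Lemma pochhammers_iota p a n :
  pochhammer a (p * n) =
  p%:R ^+ (p * n) * pochhammers [seq (a + i%:R) / p%:R | i <- iota 0 p] n.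
Proof.
have -> : iota 0 p = index_iota 0 p by rewrite /index_iota subn0.
rewrite /pochhammers big_map big_mkord.
elim: n => [|n IH].
  rewrite muln0 expr0 mul1r /pochhammer big_ord0 big1 // => i _.
  by rewrite big_ord0.
under [X in _ * X]eq_bigr do rewrite /pochhammer big_ord_recr /=.
rewrite big_split /= mulnS addnC pochhammerD IH exprD -!mulrA; congr (_ * _).
rewrite mulrCA; congr (_ * _).
have -> : p%:R ^+ p = \prod_(i < p) p%:R :> R by rewrite prodr_const card_ord.
rewrite -big_split /=.
apply: eq_bigr => i _; have p0 : p%:R != 0 :> R.
  by rewrite pnatr_eq0 -lt0n (leq_ltn_trans _ (ltn_ord i)).
by rewrite natrM; field.
Qed.

Lemma pochhammers_upper q x n :
  pochhammer (q%:R * x) (q * n) = q%:R ^+ (q * n) * pochhammers (upper_params q x) n.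
Proof.
rewrite pochhammers_iota; congr (_ * pochhammers _ _).
by apply: eq_map => i; rewrite [x * _]mulrC.
Qed.

Lemma pochhammers_lower q x n : (0 < q)%N ->
  pochhammer (q%:R * x + 1) (q.-1 * n) =
  q.-1%:R ^+ (q.-1 * n) * pochhammers (lower_params q x) n.
Proof.
case: q => // q _; rewrite pochhammers_iota /lower_params /= -natr1 addrK.
congr (_ * pochhammers _ _); rewrite -[1%N]addn0 iotaDl -map_comp.
by apply: eq_map => i /=; rewrite natrD addrA [x * _]mulrC.
Qed.

Lemma hypergeom_q_rothe q x n : (0 < q)%N ->
  pochhammers (lower_params q x) n != 0 ->
  hypergeom_q q x n = rothe q n (q%:R * x).
Proof.
(* For q = 1 this is 0^0 = 1. *)
move=> q0 L0; have pp : q.-1%:R ^+ q.-1 != 0 :> R.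
  case: (q.-1) => [|p]; first by rewrite oner_neq0.
  by rewrite expf_neq0 ?natS_neq0.
have qq : q%:R ^+ q != 0 :> R by rewrite expf_neq0 // pnatr_eq0 -lt0n.
have L0' : pochhammer (q%:R * x + 1) (q.-1 * n) != 0.
  by rewrite pochhammers_lower // exprM mulf_neq0 // expf_neq0.
have -> : hypergeom_q q x n =
    pochhammer (q%:R * x) (q * n) / pochhammer (q%:R * x + 1) (q.-1 * n) / n`!%:R.
  rewrite pochhammers_upper // pochhammers_lower // !exprM.
  rewrite /hypergeom_q /fps_scale_arg /hypergeom -subn1 natrB // subn1 in pp *.
  rewrite expr_div_n; field.
  by rewrite L0 fact_neq0 expf_neq0.
case: q q0 {L0 pp qq} L0' => // q _; case: n => [|n] /= L0'.
  by rewrite !muln0 /pochhammer !big_ord0 fact0 !divr1.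
(* The upper symbol splits into its first factor y, a block equal to the lower symbol, which
   cancels, and n last factors forming the binomial. *)
have -> : (q.+1 * n.+1 = 1 + (q * n.+1 + n))%N by rewrite mulSn; lia.
rewrite !pochhammerD {1}/pochhammer big_ord1 addr0 mulrA.
set y := _ * x; set u := pochhammer _ (q * n.+1) in L0' *.
have -> : y + (1 + (q * n.+1 + n))%:R - 1 = y + 1 + (q * n.+1)%:R + n%:R - 1.
  by rewrite !natrD; ring.
rewrite gbinom_pochhammer factS natrM.
by field; rewrite L0' fact_neq0 addrC natr1 natS_neq0.
Qed.

End Pochhammer.

(** * Coefficients of the powers of h *)

Section PowerSeriesSolution.
Variables (R : numFieldType) (q : nat) (h : fps R).
Hypothesis h_eq :
  h =1 fps_comp (fps_exp (fps_add fps_one fps_X) q) (fps_mul fps_X h).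

(** Agrees with 1 + t h through degree N + 1, one more than the truncation of h. *)
Let B N : {poly R} := 1 + 'X * fps_trunc N h.

Lemma coef_B N i : (i <= N)%N -> (B N ^+ q)`_i = h i.
Proof.
move=> iN; rewrite h_eq (@fps_comp_binomial _ _ _ q).
- apply/esym/(@fps_expE _ N) => // j jN.
  rewrite coefD coef1 coefM; congr (_ + _); apply: eq_bigr => k _.
  by rewrite coefX coef_fps_trunc // (leq_trans (leq_subr _ _)).
- by move=> k; rewrite fps_exp_one_add_X.
- by rewrite /fps_mul big_ord1 mul0r.
Qed.

Lemma coef_B_exp N n r : (n <= N.+1)%N -> (B N ^+ r)`_n = rothe q n r%:R.
Proof.
move: n r; apply: (rothe_unique (c := fun n r => (B N ^+ r)`_n)).
- by move=> r; rewrite -horner_coef0 !hornerE expr1n.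
- by move=> n; rewrite expr0 coef1.
(* B^(r+1) = B^r + t h B^r, and h agrees with B^q through degree N; the factor t gains the degree N
   + 1. *)
move=> n r nN; rewrite exprS mulrDl mul1r coefD -mulrA coefXM; congr (_ + _).
rewrite exprD mulrC !coefM; apply: eq_bigr => i _.
by rewrite coef_B ?coef_fps_trunc //; have := ltn_ord i; lia.
Qed.

Lemma solution_coef0 : h 0%N = 1.
Proof.
by rewrite -(@coef_B 0) // coef_B_exp.
Qed.

Lemma solution_rotheq n : h n = rothe q n q%:R.
Proof. by rewrite -(@coef_B n) // coef_B_exp. Qed.

Lemma solution_rothe1 n : h n = rothe q n.+1 1.
Proof.
rewrite -[1]/(1%:R) -(@coef_B_exp n) // expr1 coefD coef1 coefXM add0r.
by rewrite coef_fps_trunc.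
Qed.

Lemma solution_rpow_nat m n : fps_rpow h m%:R n = rothe q n (q%:R * m%:R).
Proof.
rewrite /fps_rpow (@fps_comp_binomial _ _ _ m); last 2 first.
- by move=> k; rewrite gbinom_nat.
- by rewrite /fps_sub solution_coef0 subrr.
rewrite (@fps_expE _ n _ (B n ^+ q)) //.
  by rewrite -exprM coef_B_exp ?natrM.
by move=> j jn; rewrite coef_B // /fps_add /fps_sub addrC subrK.
Qed.

(** Both sides are polynomial in s: the left one is a finite combination of the binom(s, k) with
    coefficients free of s. *)
Lemma solution_rpow s n : fps_rpow h s n = rothe q n (q%:R * s).
Proof.
move: s; apply: polyfun_eq_nat; last by move=> m; exact: solution_rpow_nat.
- rewrite /fps_rpow /fps_comp; set e := fps_exp _.
  apply: (@polyfun_sum R n.+1 (fun k s => gbinom s k * e k n)) => k.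
  apply: polyfunM (polyfun_cst _).
  have [P HP] := @polyfun_gbinom R 1 0 k.
  by exists P => x; rewrite -HP mul1r addr0.
- exact: polyfun_rothe.
Qed.

End PowerSeriesSolution.

(** * The hypergeometric denominators as polynomials in s *)

Section Denominators.
Variable R : numFieldType.

Lemma polyfun_pochhammers_lower q n :
  polyfun (fun x : R => pochhammers (lower_params q x) n).
Proof.
rewrite /pochhammers /lower_params.
have [P HP] : polyfun (fun x : R => \prod_(i <- iota 1 q.-1)
    pochhammer ((x * q%:R + i%:R) / (q%:R - 1)) n).
  apply: polyfun_prod => i; apply: polyfun_prod => k.
  apply: polyfunD (polyfun_cst _); apply: polyfunM (polyfun_cst _).
  apply: polyfunD (polyfun_cst _).
  exact: polyfunM (@polyfun_id R) (polyfun_cst _).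
by exists P => x; rewrite -HP big_map.
Qed.

(** At s = 1 all factors of (q + 1)_{(q-1)n} are positive. Hence the denominator is not identically
    zero, and the formula for h itself needs no cancellation. *)
Lemma pochhammers_lower1_neq0 q n : (0 < q)%N ->
  pochhammers (lower_params q (1 : R)) n != 0.
Proof.
move=> q0; have : pochhammer (q%:R * 1 + 1 : R) (q.-1 * n) != 0.
  by rewrite gt_eqF // pochhammer_pos // mulr1 natr1 ltr0Sn.
by rewrite pochhammers_lower // mulf_eq0 negb_or => /andP[].
Qed.

End Denominators.

(** * Closed forms for h and its real powers *)

Theorem theorem2p2 (R : realType) (q : nat) (D : riordan R) :
  (1 <= q)%N ->
  proper_riordan D ->
  A_sequence_gf D (fps_exp (fps_add fps_one fps_X) q) ->
  let h := riordan_h D in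
  [/\ h =1 hypergeom_q q 1,
      forall n : nat, (1 <= n)%N ->
        h n.-1 = ((q%:R - 1) * n%:R + 1)^-1 * 'C(q * n, n)%:R /\
        h n.-1 = (q%:R * n%:R + 1)^-1 * 'C(q * n + 1, n)%:R,
      forall (s : R) (n : nat),
        value_after_cancellation
          (fun x => pochhammers (lower_params q x) n)
          (fun x => hypergeom_q q x n)
          s (fps_rpow h s n),
      forall (s : R) (n : nat),
        value_after_cancellation
          (fun x => (q%:R - 1) * n%:R + q%:R * x)
          (fun x => q%:R * x / ((q%:R - 1) * n%:R + q%:R * x)
                    * gbinom (q%:R * (n%:R + x) - 1) n)
          s (fps_rpow h s n)
    & forall (s j : R) (n : nat), j - s = n%:R ->
        coef_tpow h s j = fps_rpow h s n /\
        value_after_cancellation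
          (fun x => let jx := n%:R + x in (q%:R - 1) * jx + x)
          (fun x => let jx := n%:R + x in
                    q%:R * x / ((q%:R - 1) * jx + x)
                    * gbinom (q%:R * jx - 1) n)
          s (coef_tpow h s j)].
Proof.
move=> q1 _ hA h; have rpowE := solution_rpow hA.
have qE : q%:R - 1 = q.-1%:R :> R by rewrite -subn1 natrB.
have series s n : value_after_cancellation
    (fun x => (q%:R - 1) * n%:R + q%:R * x)
    (fun x => q%:R * x / ((q%:R - 1) * n%:R + q%:R * x)
              * gbinom (q%:R * (n%:R + x) - 1) n)
    s (fps_rpow h s n).
  rewrite rpowE.
  apply: (@polyfun_value_after_cancellation _ _ _ (fun x => rothe q n (q%:R * x))).
  - apply: polyfunD (polyfun_cst _) _.
    exact: polyfunM (polyfun_cst _) (@polyfun_id R).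
  - exact: polyfun_rothe.
  (* At x = 1 the denominator is (q - 1)n + q > 0. *)
  - by exists 1; rewrite gt_eqF // ltr_wpDl ?mulr1 ?ltr0n // qE -natrM ler0n.
  - move=> x; rewrite qE -natrM [X in X != 0 -> _]addrC => den0.
    rewrite rothe_gbinom // [in RHS]addrC; congr (_ * gbinom _ _).
    by rewrite natrM; ring.
split=> //.
- move=> n; rewrite hypergeom_q_rothe ?pochhammers_lower1_neq0 //.
  by rewrite mulr1; exact: solution_rotheq hA n.
- by case=> // n _; rewrite /= /h (solution_rothe1 hA); exact: rothe1.
- move=> s n; rewrite rpowE.
  apply: (@polyfun_value_after_cancellation _ _ _ (fun x => rothe q n (q%:R * x))).
  + exact: polyfun_pochhammers_lower.
  + exact: polyfun_rothe.
  + by exists 1; exact: pochhammers_lower1_neq0.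
  + by move=> x; exact: hypergeom_q_rothe.
- move=> s j n jsn; have tpowE : coef_tpow h s j = fps_rpow h s n.
    by rewrite /coef_tpow jsn natr_nat natrK.
  split=> //; rewrite tpowE; have [P [Q [Q0 denQ coefP PE]]] := series s n.
  (* With j = n + x, the last formula is the series formula rewritten, so the same polynomials
     serve. *)
  have denE (x : R) : (q%:R - 1) * (n%:R + x) + x = (q%:R - 1) * n%:R + q%:R * x.
    by ring.
  exists P, Q; split=> // x /=; first by rewrite denE denQ.
  by rewrite denE => /coefP.
Qed.
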